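(* In the CoMesh protocol (described in the context), under either of its two locking strategies (Sequential Lock-Acquiring, SLA, or Optimistic Lock-Acquiring, OLA), no two routines are stuck in a deadlock; that is, at no time do two routines lie on a common directed cycle of the wait-for relation.
   Context: System model. There is a finite set of devices with distinct, totally ordered IDs; a subset of them are smart devices (nodes), which can compute, store state and exchange messages. Nodes may crash, with at most $f$ simultaneous failures. Messages may be lost; an unacknowledged request is resent after a timeout. Let $k=2f+1$. Every device and every routine is assigned a $k$-group, i.e. a set of $k$ nodes, with one acting leader (device leader or routine leader) that is an alive member; when a leader fails, a new leader is elected among the alive members. A leader's decisions take effect only after being replicated at a quorum of at least $f+1$ members. On leader failure the new leader reconstructs the state (in particular the lock holder and the lock queue of a device, the latter ordered by request sequence numbers) from the members' replicated copies; at an epoch change the $k$-group is replaced by a new one whose leader obtains the old group's state from the old leader, or from the old members if that leader has failed, and replicates it at a quorum of the new group. No new requests are processed during leader or epoch change. Routines. A routine has a set of touched devices (those on which its commands act). When triggered, it acquires the locks of all touched devices, then executes its commands, then releases all its locks. The lock of a device is maintained by its device $k$-group, whose leader grants it to at most one routine at a time. SLA: the routine acquires its locks one at a time, in increasing order of device ID; if a requested lock is not available, the request waits in the device leader's FIFO wait list, while the routine keeps the locks it already holds. OLA: the routine requests all its locks simultaneously. A request for a device already (pre-)locked by another routine is refused (not queued); if any request is refused, the routine releases all locks it acquired and retries all of them after a backoff timeout. Wait-for relation: routine $R$ waits for routine $R'$ at a given time if $R$ has a pending (queued) request for the lock of some device whose lock is currently held by $R'$. A deadlock is a directed cycle in this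 relation. *)

(* Defs.v *)
From Stdlib Require List.
From HB Require Import structures.
From mathcomp Require Import all_boot all_order.
Set Implicit Arguments.
Unset Strict Implicit.
Unset Printing Implicit Defensive.
Import Order.TTheory.

(* A device is identified with its ID, hence the total order on devices.      *)
Record home := Home {
  disp : Order.disp_t;
  device : finOrderType disp;
  smart : {set device};
  maxfail : nat;
  routine : eqType;
  command : Type;
  commands : routine -> seq (device * command)
}.

Definition touched (H : home) (r : routine H) : {set device H} :=
  [set d in [seq c.1 | c <- commands r]].

Definition is_kgroup (H : home) (G : {set device H}) : bool :=
  (G \subset smart H) && (#|G| == (2 * maxfail H).+1).

Definition has_quorum (H : home) (G A : {set device H}) : bool :=
  maxfail H < #|A :&: G|.

(* The number identifies the attempt of the routine at getting its locks: it  *)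
(* is renewed at each trigger and, under OLA, at each retry.                  *)
Inductive msg (H : home) :=
| LockReq  of routine H & nat & device H
| Grant    of routine H & nat & device H
| Refuse   of routine H & nat & device H
| Release  of routine H & nat & device H
| Released of routine H & nat & device H.

(* Every replicated value is stamped with (term, rank in the term), compared  *)
(* lexicographically; a new term starts with each leader or epoch change.     *)
Definition stamp := (nat * nat)%type.

Definition stamp_le (a b : stamp) : bool :=
  (a.1 < b.1) || (a.1 == b.1) && (a.2 <= b.2).

(* Traffic inside a k-group: [Query t v] and [Replicate st x v] are addressed *)
(* to v, [Report t v c] and [Stored st v] are sent by v.                      *)
Inductive gmsg (H : home) (S : Type) :=
| Query     of nat & device H
| Report    of nat & device H & (stamp * S)
| Handoff   of nat & S
| Replicate of stamp & S & device H
| Stored    of stamp & device H.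
Arguments Query {H S}.
Arguments Report {H S}.
Arguments Handoff {H S}.
Arguments Replicate {H S}.
Arguments Stored {H S}.

Record proposal (H : home) (S : Type) := Proposal {
  p_value : S;
  p_out : seq (msg H);     (* sent once the decision has taken effect *)
  p_acks : {set device H}
}.

Inductive stage (H : home) (S : Type) :=
| Collecting of seq (device H * (stamp * S))
| Installing of S & {set device H}.
Arguments Collecting {H S}.
Arguments Installing {H S}.

(* A leader change (then target is the current k-group) or an epoch change    *)
(* (then target is the next k-group) carried out by the new leader.           *)
Record change (H : home) (S : Type) := Change {
  new_leader : device H;
  target : {set device H};
  progress : stage H S
}.

(* [decided] is the state resulting from the decisions that took effect. It   *)
(* is known to the acting leader only: when [acting] is None, no step reads   *)
(* it, and a new leader has to work from [copies]. Nodes that have stored     *)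
(* nothing yet have the initial state as their copy. Messages in [wire] (and  *)
(* in [net] below) may be lost or delivered in any order.                     *)
Record kgroup (H : home) (S : Type) := KGroup {
  members : {set device H};
  acting : option (device H);
  term : nat;
  rank : nat;
  decided : S;
  pending : option (proposal H S);
  changing : option (change H S);
  copies : device H -> stamp * S;
  wire : seq (gmsg H S)
}.

Definition init_kgroup (H : home) (S : Type) (G : {set device H})
    (l : device H) (x : S) : kgroup H S :=
  KGroup G (Some l) 0 0 x None None (fun=> ((0, 0), x)) [::].

Section KGroupUpdates.
Context {H : home} {S : Type}.
Implicit Types (k : kgroup H S) (G : {set device H}) (l v : device H).

Definition set_wire k w : kgroup H S :=
  KGroup (members k) (acting k) (term k) (rank k) (decided k) (pending k)
         (changing k) (copies k) w.

Definition set_pending k p : kgroup H S :=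
  KGroup (members k) (acting k) (term k) (rank k) (decided k) p
         (changing k) (copies k) (wire k).

Definition set_changing k c : kgroup H S :=
  KGroup (members k) (acting k) (term k) (rank k) (decided k) (pending k)
         c (copies k) (wire k).

Definition set_copy k v c : kgroup H S :=
  KGroup (members k) (acting k) (term k) (rank k) (decided k) (pending k)
         (changing k) [eta copies k with v |-> c] (wire k).

Definition send k w : kgroup H S := set_wire k (wire k ++ w).

Definition queries k : seq (gmsg H S) :=
  [seq Query (term k) v | v <- enum (members k)].

Definition replicates (st : stamp) (x : S) G : seq (gmsg H S) :=
  [seq Replicate st x v | v <- enum G].

(* A leader serves requests only outside leader and epoch changes, one        *)
(* decision at a time.                                                        *)
Definition serving k : bool :=
  [&& acting k, ~~ changing k & ~~ pending k].

Definition propose k (x : S) (out : seq (msg H)) : kgroup H S :=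
  let k' := KGroup (members k) (acting k) (term k) (rank k).+1 (decided k)
                   (Some (Proposal x out set0)) (changing k) (copies k)
                   (wire k) in
  send k' (replicates (term k, (rank k).+1) x (members k)).

Definition decide k (x : S) : kgroup H S :=
  KGroup (members k) (acting k) (term k) (rank k) x None (changing k)
         (copies k) (wire k).

(* The decision under replication, if any, is abandoned. *)
Definition begin_change k l G : kgroup H S :=
  let k' := KGroup (members k) (acting k) (term k).+1 (rank k) (decided k) None
                   (Some (Change l G (Collecting [::]))) (copies k) (wire k) in
  send k' (queries k').

Definition begin_install k l G (x : S) : kgroup H S :=
  send (set_changing k (Some (Change l G (Installing x set0))))
       (replicates (term k, 0) x G).

Definition complete_change k l G (x : S) : kgroup H S :=
  KGroup G (Some l) (term k) 0 x None None (copies k) (wire k).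

(* A crash destroys the volatile state of a node (its role as a leader), not  *)
(* the replicated copies it has stored.                                       *)
Definition crash_kgroup v k : kgroup H S :=
  let lead := acting k == Some v in
  KGroup (members k)
         (if lead then None else acting k) (term k) (rank k) (decided k)
         (if lead then None else pending k)
         (if changing k is Some c then
            if new_leader c == v then None else Some c
          else None)
         (copies k) (wire k).

Definition reporters (rs : seq (device H * (stamp * S))) : {set device H} :=
  [set v in [seq vc.1 | vc <- rs]].

Definition latest (rs : seq (device H * (stamp * S))) (c : stamp * S) : Prop :=
  (exists v, List.In (v, c) rs)
  /\ forall v c', List.In (v, c') rs -> stamp_le c'.1 c.1.

(* Steps of a k-group when the nodes in F are down; the label lists the       *)
(* messages sent outside the k-group. [rebuild] is applied to the most recent *)
(* copy when a new leader reconstructs the state.                             *)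
Inductive group_step (rebuild : S -> S) (F : {set device H}) k :
    seq (msg H) -> kgroup H S -> Prop :=
| G_lose w1 m w2 of wire k = w1 ++ m :: w2 :
    group_step rebuild F k [::] (set_wire k (w1 ++ w2))
| G_elect l of acting k = None & changing k = None
    & l \in members k & l \notin F :
    group_step rebuild F k [::] (begin_change k l (members k))
| G_epoch l G of changing k = None & is_kgroup G & l \in G & l \notin F :
    group_step rebuild F k [::] (begin_change k l G)
| G_requery l G rs of changing k = Some (Change l G (Collecting rs)) :
    group_step rebuild F k [::] (send k (queries k))
| G_answer w1 t v w2 of wire k = w1 ++ Query t v :: w2 & v \notin F :
    group_step rebuild F k [::]
      (send (set_wire k (w1 ++ w2))
         [:: if acting k == Some v then Handoff t (decided k)
             else Report t v (copies k v)])
| G_report w1 t v c w2 l G rs of wire k = w1 ++ Report t v c :: w2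
    & changing k = Some (Change l G (Collecting rs)) & t = term k :
    group_step rebuild F k [::]
      (set_changing (set_wire k (w1 ++ w2))
         (Some (Change l G (Collecting ((v, c) :: rs)))))
| G_handoff w1 t x w2 l G rs of wire k = w1 ++ Handoff t x :: w2
    & changing k = Some (Change l G (Collecting rs)) & t = term k :
    group_step rebuild F k [::] (begin_install (set_wire k (w1 ++ w2)) l G x)
| G_rebuild l G rs c of changing k = Some (Change l G (Collecting rs))
    & acting k = None & has_quorum (members k) (reporters rs) & latest rs c :
    group_step rebuild F k [::] (begin_install k l G (rebuild c.2))
| G_store w1 st x v w2 of wire k = w1 ++ Replicate st x v :: w2 & v \notin F
    & stamp_le (copies k v).1 st :
    group_step rebuild F k [::]
      (send (set_copy (set_wire k (w1 ++ w2)) v (st, x)) [:: Stored st v])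
| G_ack_proposal w1 st v w2 x out A of wire k = w1 ++ Stored st v :: w2
    & pending k = Some (Proposal x out A) & st = (term k, rank k) :
    group_step rebuild F k [::]
      (set_pending (set_wire k (w1 ++ w2)) (Some (Proposal x out (v |: A))))
| G_ack_install w1 st v w2 l G x A of wire k = w1 ++ Stored st v :: w2
    & changing k = Some (Change l G (Installing x A)) & st = (term k, 0) :
    group_step rebuild F k [::]
      (set_changing (set_wire k (w1 ++ w2))
         (Some (Change l G (Installing x (v |: A)))))
| G_resend_proposal x out A of pending k = Some (Proposal x out A) :
    group_step rebuild F k [::]
      (send k (replicates (term k, rank k) x (members k :\: A)))
| G_resend_install l G x A of changing k = Some (Change l G (Installing x A)) :
    group_step rebuild F k [::]
      (send k (replicates (term k, 0) x (G :\: A)))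
| G_decide x out A of pending k = Some (Proposal x out A)
    & has_quorum (members k) A :
    group_step rebuild F k out (decide k x)
| G_complete l G x A of changing k = Some (Change l G (Installing x A))
    & has_quorum G A :
    group_step rebuild F k [::] (complete_change k l G x).

End KGroupUpdates.

Inductive strategy := SLA | OLA.

(* The wait list consists of (sequence number, (routine, attempt)). Attempts  *)
(* of r numbered less than [closed r] are over for this device (released or   *)
(* refused), so that late duplicates of their requests can be recognized.     *)
Record lock (H : home) := Lock {
  holder : option (routine H * nat);
  queue : seq (nat * (routine H * nat));
  next_seq : nat;
  closed : routine H -> nat
}.

Definition init_lock (H : home) : lock H := Lock None [::] 0 (fun=> 0).

Definition by_seq (H : home) (L : lock H) : lock H :=
  Lock (holder L) (sort (fun a b => a.1 <= b.1) (queue L)) (next_seq L)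
       (closed L).

Definition close (H : home) (L : lock H) (r : routine H) (n : nat) :
    routine H -> nat :=
  [eta closed L with r |-> maxn (closed L r) n.+1].

Definition on_request (H : home) (str : strategy) (d : device H) (L : lock H)
    (r : routine H) (n : nat) : lock H * seq (msg H) :=
  if n < closed L r then
    (L, if str is OLA then [:: Refuse r n d] else [::])
  else if holder L == Some (r, n) then (L, [:: Grant r n d])
  else if (r, n) \in [seq q.2 | q <- queue L] then (L, [::])
  else if holder L is None then
    (Lock (Some (r, n)) (queue L) (next_seq L) (closed L), [:: Grant r n d])
  else match str with
  | SLA => (Lock (holder L) (rcons (queue L) (next_seq L, (r, n)))
                 (next_seq L).+1 (closed L), [::])
  | OLA => (Lock (holder L) (queue L) (next_seq L) (close L r n),
            [:: Refuse r n d])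
  end.

Definition on_release (H : home) (d : device H) (L : lock H)
    (r : routine H) (n : nat) : lock H * seq (msg H) :=
  if holder L == Some (r, n) then
    if queue L is (_, (r', n')) :: q then
      (Lock (Some (r', n')) q (next_seq L) (close L r n),
       [:: Released r n d; Grant r' n' d])
    else (Lock None [::] (next_seq L) (close L r n), [:: Released r n d])
  else (L, [:: Released r n d]).

Definition device_receive (H : home) (str : strategy) (d : device H)
    (L : lock H) (m : msg H) : option (lock H * seq (msg H)) :=
  match m with
  | LockReq r n e => if e == d then Some (on_request str d L r n) else None
  | Release r n e => if e == d then Some (on_release d L r n) else None
  | _ => None
  end.

(* [Executing i]: the first i commands have been executed. *)
Inductive phase := Idle | Acquiring | Executing of nat | Releasing | Backoff.

Record run (H : home) := Run {
  phase_of : phase;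
  attempt : nat;
  acquired : {set device H};
  refused : {set device H}
}.

Definition init_run (H : home) : run H := Run Idle 0 set0 set0.

Definition release_phase (H : home) (acq ref : {set device H}) : phase :=
  if acq != set0 then Releasing else if ref == set0 then Idle else Backoff.

(* Under SLA no request is refused, so ref is empty. *)
Definition acquire_phase (H : home) (r : routine H) (acq ref : {set device H}) :
    phase :=
  if ~~ (touched r \subset acq :|: ref) then Acquiring
  else if ref == set0 then Executing 0
  else release_phase acq ref.

Definition start_attempt (H : home) (r : routine H) (p : run H) : run H :=
  Run (acquire_phase r set0 set0) (attempt p).+1 set0 set0.

Definition routine_receive (H : home) (r : routine H) (p : run H) (m : msg H) :
    option (run H) :=
  let a := acquired p in
  let u := refused p in
  match m, phase_of p with
  | Grant r' n d, Acquiring =>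
      if (r' == r) && (n == attempt p) then
        Some (Run (acquire_phase r (d |: a) u) n (d |: a) u)
      else None
  | Refuse r' n d, Acquiring =>
      if (r' == r) && (n == attempt p) then
        Some (Run (acquire_phase r a (d |: u)) n a (d |: u))
      else None
  | Released r' n d, Releasing =>
      if (r' == r) && (n == attempt p) then
        Some (Run (release_phase (a :\ d) u) n (a :\ d) u)
      else None
  | _, _ => None
  end.

Inductive routine_local (H : home) (r : routine H) (p : run H) :
    run H -> Prop :=
| R_trigger of phase_of p = Idle : routine_local r p (start_attempt r p)
| R_retry of phase_of p = Backoff : routine_local r p (start_attempt r p)
| R_command i of phase_of p = Executing i & i < size (commands r) :
    routine_local r p (Run (Executing i.+1) (attempt p) (acquired p) (refused p))
| R_finish of phase_of p = Executing (size (commands r)) :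
    routine_local r p
      (Run (release_phase (acquired p) (refused p)) (attempt p)
           (acquired p) (refused p)).

(* The unanswered requests of a routine: SLA asks for one lock at a time, by  *)
(* increasing ID, OLA for all of them at once.                                *)
Definition outstanding (H : home) (str : strategy) (r : routine H) (p : run H) :
    seq (msg H) :=
  match phase_of p with
  | Acquiring =>
      let todo := sort <=%O (enum (touched r :\: (acquired p :|: refused p))) in
      [seq LockReq r (attempt p) d |
         d <- match str with SLA => take 1 todo | OLA => todo end]
  | Releasing => [seq Release r (attempt p) d | d <- enum (acquired p)]
  | _ => [::]
  end.

Record state (H : home) := State {
  failed : {set device H};
  locks : device H -> kgroup H (lock H);
  runs : routine H -> kgroup H (run H);
  net : seq (msg H)
}.

Definition initial (H : home) (s : state H) : Prop :=
  [/\ failed s = set0,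
      forall d, exists G l, [/\ is_kgroup G, l \in G
        & locks s d = init_kgroup G l (init_lock H)],
      forall r, exists G l, [/\ is_kgroup G, l \in G
        & runs s r = init_kgroup G l (init_run H)]
    & net s = [::]].

Inductive step (H : home) (str : strategy) (s : state H) : state H -> Prop :=
| S_crash v of v \in smart H :\: failed s & #|failed s| < maxfail H :
    step str s (State (v |: failed s) (fun d => crash_kgroup v (locks s d))
                      (fun r => crash_kgroup v (runs s r)) (net s))
| S_recover v of v \in failed s :
    step str s (State (failed s :\ v) (locks s) (runs s) (net s))
| S_lose n1 m n2 of net s = n1 ++ m :: n2 :
    step str s (State (failed s) (locks s) (runs s) (n1 ++ n2))
| S_device_group d out k
    of group_step (@by_seq H) (failed s) (locks s d) out k :
    step str s (State (failed s) [eta locks s with d |-> k] (runs s)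
                      (net s ++ out))
| S_routine_group r out k of group_step id (failed s) (runs s r) out k :
    step str s (State (failed s) (locks s) [eta runs s with r |-> k]
                      (net s ++ out))
| S_device_receive d n1 m n2 L out of net s = n1 ++ m :: n2
    & serving (locks s d)
    & device_receive str d (decided (locks s d)) m = Some (L, out) :
    step str s (State (failed s)
                      [eta locks s with d |-> propose (locks s d) L out]
                      (runs s) (n1 ++ n2))
| S_routine_receive r n1 m n2 p of net s = n1 ++ m :: n2
    & serving (runs s r)
    & routine_receive r (decided (runs s r)) m = Some p :
    step str s (State (failed s) (locks s)
                      [eta runs s with
                         r |-> propose (runs s r) p (outstanding str r p)]
                      (n1 ++ n2))
| S_routine_local r p of serving (runs s r)
    & routine_local r (decided (runs s r)) p :
    step str s (State (failed s) (locks s)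
                      [eta runs s with
                         r |-> propose (runs s r) p (outstanding str r p)]
                      (net s))
| S_timeout r of serving (runs s r) :
    step str s (State (failed s) (locks s) (runs s)
                      (net s ++ outstanding str r (decided (runs s r)))).

Inductive reachable (H : home) (str : strategy) : state H -> Prop :=
| Reach_init s of initial s : reachable str s
| Reach_step s s' of reachable str s & step str s s' : reachable str s'.

Definition holds (H : home) (s : state H) (r : routine H) (d : device H) : bool :=
  omap fst (holder (decided (locks s d))) == Some r.

Definition requests (H : home) (s : state H) (r : routine H) (d : device H) :
    bool :=
  r \in [seq q.2.1 | q <- queue (decided (locks s d))].

(* The lock state of a device is the one in force at its k-group. *)
Definition waits_for (H : home) (s : state H) : rel (routine H) :=
  fun r r' => [exists d, requests s r d && holds s r' d].

Definition deadlocked (H : home) (s : state H) (r r' : routine H) : Prop :=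
  exists c : seq (routine H), [/\ cycle (waits_for s) c, r \in c & r' \in c].

(* Main.v *)
(* A k-group behaves as a single register: any quorum of copies consulted by  *)
(* a new leader meets the quorum that stored the decided value, so what it    *)
(* rebuilds is the decided value or a proposal computed from it. Every step   *)
(* of a device or a routine is thus taken from a decided state, and decided   *)
(* states never roll back.                                                    *)
(*                                                                            *)
(* Under OLA wait lists stay empty. Under SLA, that attempt n of r has been   *)
(* granted the lock of d, or is over at d, is stable under all steps, and a   *)
(* request of attempt n for d is sent only once it is true of all the touched *)
(* devices below d, and once earlier attempts are over everywhere. Hence a    *)
(* queued routine holds only locks of devices below the one it waits for;     *)
(* along a cycle of the wait-for relation the device IDs would increase       *)
(* forever.                                                                   *)
From Stdlib Require List.
Require Import Defs.
From mathcomp Require Import all_boot all_order.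
Set Implicit Arguments.
Unset Strict Implicit.
Unset Printing Implicit Defensive.
Import Order.TTheory Defs.

(** Replication reduces each k-group to one register. The invariant [safe] says that every copy
    stamped no earlier than the decision in force is acceptable ([Acc]) from the decided value;
    quorum intersection makes it inductive ([safe_group_step], [safe_propose]). Instantiating [Acc]
    then yields invariants of decided states. Under OLA the invariant is an empty wait list
    ([ola_queue_empty]), so nobody waits. Under SLA it is [protocol_ok], which ties locks, runs and
    messages together ([protocol_step]) and gives [holds_lt_requests]: a routine holds only devices
    below any it is queued for. Going once around a cycle would put a device below itself
    ([holds_path_lt_requests]). *)

Lemma stamp_le_refl a : stamp_le a a.
Proof. by rewrite /stamp_le eqxx leqnn orbT. Qed.

Lemma stamp_le_trans b a c : stamp_le a b -> stamp_le b c -> stamp_le a c.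
Proof.
rewrite /stamp_le => /orP[ab|/andP[/eqP-> ab]] /orP[bc|/andP[/eqP<- bc]].
- by rewrite (ltn_trans ab bc).
- by rewrite ab.
- by rewrite bc.
- by rewrite eqxx (leq_trans ab bc) orbT.
Qed.

Lemma In_mid T (m : T) w1 x w2 :
  List.In m (w1 ++ w2) -> List.In m (w1 ++ x :: w2).
Proof.
by elim: w1 => [|y w1 IH] /=; [right | move=> [->|/IH]; [left|right]].
Qed.

Lemma In_cat T (m : T) w1 w2 :
  List.In m (w1 ++ w2) -> List.In m w1 \/ List.In m w2.
Proof. exact: List.in_app_or. Qed.

Lemma In_map (I : eqType) T (f : I -> T) (s : seq I) m :
  List.In m [seq f i | i <- s] -> exists2 i, i \in s & m = f i.
Proof.
elim: s => [|i s IH] //= [<-|/IH[j js ->]].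
  by exists i; rewrite ?mem_head.
by exists j; rewrite // inE js orbT.
Qed.

(** * Quorum replication as a single register *)

Section Replication.
Context {H : home} {S : Type}.
(* [Acc D x] reads: a group whose decided value is [D] may come to decide [x] *)
(* instead, either by a regular decision or because a new leader found an     *)
(* abandoned proposal.                                                        *)
Context (Acc : S -> S -> Prop) (Out : S -> msg H -> Prop).
Implicit Types (k : kgroup H S) (ds : stamp) (Q : {set device H}).

Lemma In_replicates st x G m :
  List.In m (@replicates H S st x G) -> exists v, m = Replicate st x v.
Proof. by move=> h; case: (In_map h) => v _ ->; exists v. Qed.

Lemma In_queries k m :
  List.In m (queries k) -> exists v, m = Query (term k) v.
Proof. by move=> h; case: (In_map h) => v _ ->; exists v. Qed.

Lemma quorum_meet (G A B : {set device H}) :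
  is_kgroup G -> has_quorum G A -> has_quorum G B ->
  exists v, (v \in A) && (v \in B).
Proof.
case/andP=> _ /eqP cG; rewrite /has_quorum => cA cB.
case: (set_0Vmem ((A :&: G) :&: (B :&: G))) => [E|[v]]; last first.
  by rewrite !inE => /andP[/andP[vA _] /andP[vB _]]; exists v; rewrite vA.
have: #|(A :&: G) :|: (B :&: G)| <= #|G|.
  by apply: subset_leq_card; rewrite subUset !subsetIr.
rewrite cardsU E cards0 subn0 cG leqNgt.
by have := leq_add cA cB; rewrite addSn addnS mul2n -addnn => ->.
Qed.

(* Makes stamps identify values: a value stamped as late as the proposal or   *)
(* the installation in progress is the value proposed or installed.           *)
Definition fresh_stamp k (c : stamp * S) : Prop :=
  c.1.1 <= term k /\ (c.1.1 = term k ->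
    match changing k with
    | Some (Change _ _ (Collecting _)) => False
    | Some (Change _ _ (Installing x _)) => c = ((term k, 0), x)
    | None => c.1.2 <= rank k /\
        (if pending k is Some p then c.1.2 = rank k -> c.2 = p_value p
         else True)
    end).

(** Copies older than [ds] may hold superseded values and need not be acceptable: the latest report
    of a quorum is never one of them. *)
Definition copy_ok ds k (c : stamp * S) : Prop :=
  fresh_stamp k c /\ (stamp_le ds c.1 -> Acc (decided k) c.2).

Definition report_ok ds Q k v (c : stamp * S) : Prop :=
  (v \in Q -> stamp_le ds c.1) /\ (stamp_le ds c.1 -> Acc (decided k) c.2).

(** Reports and handoffs are constrained only during the change that solicited them: afterwards
    [changing] is empty, and the next change opens a new term, so leftovers are never read. *)
Definition gmsg_ok ds Q k (m : gmsg H S) : Prop :=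
  match m with
  | Query t _ => t <= term k
  | Report t v c => t <= term k /\
      (t = term k -> changing k -> report_ok ds Q k v c)
  | Handoff t x => t <= term k /\
      (t = term k -> changing k -> Acc (decided k) x)
  | Replicate st x _ => copy_ok ds k (st, x)
  | Stored st v => stamp_le st (copies k v).1
  end.

Definition pending_ok k : Prop :=
  if pending k is Some (Proposal x out A) then
    [/\ changing k = None, Acc (decided k) x,
        forall m, List.In m out -> Out x m
      & forall v, v \in A -> stamp_le (term k, rank k) (copies k v).1]
  else True.

Definition changing_ok ds Q k : Prop :=
  if changing k is Some (Change _ G st) then
    is_kgroup G /\
    match st with
    | Collecting rs => forall v c, List.In (v, c) rs -> report_ok ds Q k v c
    | Installing x A => Acc (decided k) x /\
        forall v, v \in A -> stamp_le (term k, 0) (copies k v).1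
    end
  else True.

(* [ds] is the stamp under which the decided value took effect and [Q] a      *)
(* quorum that had stored it by then. [Q] is fixed until the next decision,   *)
(* so that a report sent by a member of [Q] remains recent enough even when   *)
(* its sender later stores other late copies.                                 *)
Record safe_at ds Q k : Prop := SafeAt {
  safe_members : is_kgroup (members k);
  safe_quorum : has_quorum (members k) Q;
  safe_Q : forall v, v \in Q -> stamp_le ds (copies k v).1;
  safe_decided : Acc (decided k) (decided k);
  safe_copies : forall v, copy_ok ds k (copies k v);
  safe_pending : pending_ok k;
  safe_changing : changing_ok ds Q k;
  safe_wire : forall m, List.In m (wire k) -> gmsg_ok ds Q k m
}.

Definition safe k : Prop := exists ds Q, safe_at ds Q k.

Lemma safe_acc_decided k : safe k -> Acc (decided k) (decided k).
Proof. by case=> ds [Q /safe_decided]. Qed.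

Lemma safe_init G l x : is_kgroup G -> Acc x x -> safe (init_kgroup G l x).
Proof.
move=> kG xx; exists (0, 0), G; split=> //=.
rewrite /has_quorum setIid (eqP (proj2 (andP kG))).
by rewrite ltnS mul2n -addnn leq_addr.
Qed.

Lemma safe_set_wire ds Q k w : safe_at ds Q k ->
  (forall m, List.In m w -> gmsg_ok ds Q k m) -> safe_at ds Q (set_wire k w).
Proof. by case. Qed.

Lemma safe_send ds Q k w : safe_at ds Q k ->
  (forall m, List.In m w -> gmsg_ok ds Q k m) -> safe_at ds Q (send k w).
Proof.
move=> sk okw; apply: safe_set_wire => // m mw.
case: (In_cat mw) => [mk|]; last exact: okw.
exact: (safe_wire sk).
Qed.

Lemma safe_take ds Q k w1 m w2 : safe_at ds Q k -> wire k = w1 ++ m :: w2 ->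
  safe_at ds Q (set_wire k (w1 ++ w2)) /\ gmsg_ok ds Q k m.
Proof.
move=> sk E; split; last first.
  by apply: (safe_wire sk); rewrite E; apply: List.in_elt.
apply: safe_set_wire => // m' m'w; apply: (safe_wire sk); rewrite E.
exact: In_mid.
Qed.

(** The new rank exceeds every rank stamped in this term, so no existing copy can be mistaken for
    the proposal. *)
Lemma safe_propose k x out : safe k -> serving k -> Acc (decided k) x ->
  (forall m, List.In m out -> Out x m) -> safe (propose k x out).
Proof.
case=> ds [Q [Hm Hq HQ Hd Hc Hp Hch Hw]] /and3P[_ nch npe] ax okout.
have E1 : changing k = None by case: (changing k) nch.
have E2 : pending k = None by case: (pending k) npe.
exists ds, Q.
have fr c : copy_ok ds k c ->
    copy_ok ds (set_wire (propose k x out) (wire k)) c.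
  case=> -[le1 H1] H2; split=> //; split=> //= /H1; rewrite E1 => -[le2 _].
  by split=> [|E]; [exact: leqW | move: le2; rewrite E ltnn].
apply: safe_send.
  split=> //=.
  - by move=> v; apply/fr/Hc.
  - by rewrite /pending_ok /=; split=> // v; rewrite inE.
  by case=> [t v|t v c|t y|st y v|st v] /Hw //=; exact: fr.
move=> _ /In_replicates[v ->] /=; split=> //; split=> //= _.
by rewrite E1.
Qed.

Lemma safe_crash v k : safe k -> safe (crash_kgroup v k).
Proof.
case=> ds [Q [Hm Hq HQ Hd Hc Hp Hch Hw]]; exists ds, Q.
have fr c : copy_ok ds k c -> copy_ok ds (crash_kgroup v k) c.
  case=> -[le1 H1] H2; split=> //; split=> //= /H1.
  move: Hp; rewrite /pending_ok.
  case: (pending k) => [[x out A] [-> _ _ _]|_]; first by case: ifP => // _ [].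
  case: (changing k) => [[l G [rs|x A]]|] //=.
    by case: ifP => // _ ->; rewrite if_same.
  by rewrite if_same.
split=> //=.
- by move=> u; apply/fr/Hc.
- rewrite /pending_ok /=; case: ifP => // _; move: Hp; rewrite /pending_ok.
  by case: (pending k) => // -[x out A] [-> *]; split.
- rewrite /changing_ok /=; move: Hch; rewrite /changing_ok.
  by case: (changing k) => // -[l G p] /=; case: ifP.
case=> [t u|t u c|t y|st y u|st u] /Hw //=.
- move=> [? h]; split=> // /h {}h.
  by case: (changing k) h => // c' h _; apply: h.
- move=> [? h]; split=> // /h {}h.
  by case: (changing k) h => // c' h _; apply: h.
exact: fr.
Qed.

Lemma safe_begin_change ds Q k l G : safe_at ds Q k -> is_kgroup G ->
  safe_at ds Q (begin_change k l G).
Proof.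
case=> Hm Hq HQ Hd Hc Hp Hch Hw kG.
have fr c : copy_ok ds k c ->
    copy_ok ds (set_wire (begin_change k l G) (wire k)) c.
  case=> -[le1 H1] H2; split=> //; split=> /= [|E]; first exact: leqW.
  by move: le1; rewrite E ltnn.
apply: safe_send; last by move=> _ /In_queries[v ->] /=.
split=> //=; first by move=> v; apply/fr/Hc.
case=> [t v|t v c|t y|st y v|st v] /Hw //=; first exact: leqW.
- by move=> [le1 _]; split=> [|E]; [exact: leqW | move: le1; rewrite E ltnn].
- by move=> [le1 _]; split=> [|E]; [exact: leqW | move: le1; rewrite E ltnn].
exact: fr.
Qed.

(** While reports are collected no copy bears the current term, so [(term k, 0)] is a fresh stamp
    for [x]. *)
Lemma safe_begin_install ds Q k l G rs x : safe_at ds Q k ->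
  changing k = Some (Change l G (Collecting rs)) -> Acc (decided k) x ->
  safe_at ds Q (begin_install k l G x).
Proof.
case=> Hm Hq HQ Hd Hc Hp Hch Hw E ax.
move: Hch; rewrite /changing_ok E => -[kG _].
have fr c : copy_ok ds k c ->
    copy_ok ds (set_wire (begin_install k l G x) (wire k)) c.
  by case=> -[le1 H1] H2; split=> //; split=> //= /H1; rewrite E.
have Hp' : pending k = None.
  move: Hp; rewrite /pending_ok.
  by case: (pending k) => // -[? ? ?] []; rewrite E.
apply: safe_send; last first.
  by move=> _ /In_replicates[v ->] /=; split.
split=> //=; first by move=> v; apply/fr/Hc.
- by rewrite /pending_ok /= Hp'.
- by split=> //; split=> // v; rewrite inE.
case=> [t v|t v c|t y|st y v|st v] /Hw //=.
- by rewrite E.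
- by rewrite E.
exact: fr.
Qed.

Lemma reporters_In (rs : seq (device H * (stamp * S))) v :
  v \in reporters rs -> exists c, List.In (v, c) rs.
Proof.
rewrite inE; elim: rs => [|[u c] rs IH] //=; rewrite inE.
case/orP=> [/eqP->|/IH[c' h]].
  by exists c; left.
by exists c'; right.
Qed.

(** A decision or a completed change resets [ds] to the stamp just acknowledged and [Q] to the
    acknowledging set; [Acc D x -> Acc x x] then rebases acceptability on the new value. *)
Lemma safe_group_step (rebuild : S -> S) F k out k' :
  (forall D x, Acc D x -> Acc x x) ->
  (forall D x, Acc D x -> Acc D (rebuild x)) ->
  safe k -> group_step rebuild F k out k' ->
  [/\ safe k', Acc (decided k) (decided k')
    & forall m, List.In m out -> Out (decided k') m].
Proof.
move=> Axx Areb [ds [Q sk]] st; have Hd := safe_decided sk.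
have same k'' : safe_at ds Q k'' -> decided k'' = decided k ->
    [/\ safe k'', Acc (decided k) (decided k'')
      & forall m, List.In m [::] -> Out (decided k'') m].
  by move=> sk'' ->; split=> //; exists ds, Q.
case: st => [w1 m w2 E|l _ _ _ _|l G _ kG _ _|l G rs E|w1 t v w2 E _
  |w1 t v c w2 l G rs E Ec Et|w1 t x w2 l G rs E Ec Et|l G rs c Ec Ea hq lat
  |w1 st x v w2 E _ le|w1 st v w2 x out' A E Ep Est|w1 st v w2 l G x A E Ec Est
  |x out' A Ep|l G x A Ec|x out' A Ep hq|l G x A Ec hq].
- by apply: same => //; case: (safe_take sk E).
- by apply: same => //; apply: safe_begin_change => //; apply: safe_members sk.
- by apply: same => //; apply: safe_begin_change.
- by apply: same => //; apply: safe_send => // _ /In_queries[v ->] /=.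
- have [sk' tle] := safe_take sk E; apply: same => //; apply: safe_send => //.
  move=> _ [<-|[]]; case: ifP => _ /=; split=> // _ _.
  by split; [apply: (safe_Q sk) | case: (safe_copies sk v)].
- have [[Hm Hq HQ _ Hc Hp Hch Hw] [_ mok]] := safe_take sk E; apply: same => //.
  move: Hch; rewrite /changing_ok /= Ec => -[kG Hrs].
  have fr c' : copy_ok ds k c' ->
    copy_ok ds (set_changing (set_wire k (w1 ++ w2))
      (Some (Change l G (Collecting ((v, c) :: rs))))) c'.
    by case=> -[le1 H1] H2; split=> //; split=> //= /H1; rewrite Ec.
  split=> //=; first by move=> u; apply/fr/Hc.
  + move: Hp; rewrite /pending_ok /=; case: (pending k) => // -[? ? ?] [].
    by rewrite Ec.
  + split=> // u c' [[<- <-]|/Hrs//]; apply: mok => //; by rewrite Ec.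
  case=> [t' u|t' u c'|t' y|st y u|st u] /Hw //=; rewrite ?Ec //.
  exact: fr.
- have [sk' [_ mok]] := safe_take sk E; apply: same => //.
  apply: safe_begin_install => //; first exact: Ec.
  by apply: mok => //; rewrite Ec.
- apply: same => //; apply: safe_begin_install => //; first exact: Ec.
  apply: Areb; case: lat => -[u uc] maxc.
  have := safe_changing sk; rewrite /changing_ok Ec => -[kG Hrs].
  (* The report of a node [v] common to both quorums is no older than [ds]; the latest report is at
     least as recent, hence acceptable. *)
  have [v /andP[vr vQ]] := quorum_meet (safe_members sk) hq (safe_quorum sk).
  have [c' vc'] := reporters_In vr.
  apply: (proj2 (Hrs _ _ uc)); apply: stamp_le_trans (maxc _ _ vc').
  exact: (proj1 (Hrs _ _ vc')).
- have [[Hm Hq HQ _ Hc Hp Hch Hw] mok] := safe_take sk E; apply: same => //.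
  set k1 := set_copy _ _ _.
  (* Stores only raise stamps, so [Q] and earlier acknowledgements stay justified. *)
  have mono a u : stamp_le a (copies k u).1 -> stamp_le a (copies k1 u).1.
    rewrite /k1 /= => h; case: eqP => [uv|_] //.
    by rewrite uv in h; apply: stamp_le_trans h le.
  apply: safe_send; last first.
    by move=> _ [<-|[]] /=; rewrite /k1 /= eqxx stamp_le_refl.
  split=> //.
  + by move=> u /HQ; apply: mono.
  + by move=> u; rewrite /k1 /=; case: eqP => // _; apply: (safe_copies sk).
  + move: Hp; rewrite /pending_ok /=.
    case: (pending k) => // -[y o A] [? ? ? h].
    by split=> // u /h; apply: mono.
  + move: Hch; rewrite /changing_ok /=.
    case: (changing k) => // -[l G [rs|y A]] //.
    by move=> [? [? h]]; split=> //; split=> // u /h; apply: mono.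
  by case=> [t' u|t' u c'|t' y|st' y u|st' u] /Hw //=; apply: mono.
- have [[Hm Hq HQ _ Hc Hp Hch Hw] /= mok] := safe_take sk E; apply: same => //.
  move: Hp; rewrite /pending_ok /= Ep => -[Ec ax oko hA].
  have fr c' : copy_ok ds k c' ->
    copy_ok ds (set_pending (set_wire k (w1 ++ w2))
      (Some (Proposal x out' (v |: A)))) c'.
    by case=> -[le1 H1] H2; split=> //; split=> //= /H1; rewrite Ec Ep.
  split=> //=; first by move=> u; apply/fr/Hc.
  + by split=> // u; rewrite !inE => /orP[/eqP->|/hA//]; rewrite -Est.
  case=> [t' u|t' u c'|t' y|st' y u|st' u] /Hw //=.
  exact: fr.
- have [[Hm Hq HQ _ Hc Hp Hch Hw] /= mok] := safe_take sk E; apply: same => //.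
  move: Hch; rewrite /changing_ok /= Ec => -[kG [ax hA]].
  have fr c' : copy_ok ds k c' ->
    copy_ok ds (set_changing (set_wire k (w1 ++ w2))
      (Some (Change l G (Installing x (v |: A))))) c'.
    by case=> -[le1 H1] H2; split=> //; split=> //= /H1; rewrite Ec.
  split=> //=; first by move=> u; apply/fr/Hc.
  + move: Hp; rewrite /pending_ok /=; case: (pending k) => // -[? ? ?] [].
    by rewrite Ec.
  + split=> //; split=> // u; rewrite !inE => /orP[/eqP->|/hA//].
    by rewrite -Est.
  case=> [t' u|t' u c'|t' y|st' y u|st' u] /Hw //=; rewrite ?Ec //.
  exact: fr.
- apply: same => //; apply: safe_send => // _ /In_replicates[v ->] /=.
  have := safe_pending sk; rewrite /pending_ok Ep => -[Ec ax _ _].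
  by split=> //; split=> //= _; rewrite Ec Ep.
- apply: same => //; apply: safe_send => // _ /In_replicates[v ->] /=.
  have := safe_changing sk; rewrite /changing_ok Ec => -[_ [ax _]].
  by split=> //; split=> //= _; rewrite Ec.
- have := safe_pending sk; rewrite /pending_ok Ep => -[Ec ax oko hA].
  split=> //; exists (term k, rank k), A; case: sk => Hm Hq HQ _ Hc Hp Hch Hw.
  (* A copy as late as this decision bears exactly its stamp, hence holds [x]. *)
  have fr c : copy_ok ds k c -> copy_ok (term k, rank k) (decide k x) c.
    case=> -[le1 H1] H2; split; first by split=> //= /H1; rewrite Ec => -[].
    move: H1 => /=; rewrite Ec Ep /stamp_le /= ltnNge le1 /= => H1.
    case/andP=> /eqP/esym/H1[le2 eqv] le3.
    by rewrite eqv; [apply: Axx ax | apply/eqP; rewrite eqn_leq le2 le3].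
  split=> //=.
  + exact: Axx ax.
  + by move=> v; apply/fr/Hc.
  + by rewrite /changing_ok /= Ec.
  case=> [t' u|t' u c'|t' y|st' y u|st' u] /Hw //=; rewrite ?Ec //.
  + by case.
  + by case.
  exact: fr.
have := safe_changing sk; rewrite /changing_ok Ec => -[kG [ax hA]].
split=> //; exists (term k, 0), A; case: sk => Hm Hq HQ _ Hc Hp Hch Hw.
have fr c : copy_ok ds k c -> copy_ok (term k, 0) (complete_change k l G x) c.
  case=> -[le1 H1] H2; split; first by split=> //= /H1; rewrite Ec => ->.
  move: H1 => /=; rewrite Ec /stamp_le /= ltnNge le1 /= => H1.
  by case/andP=> /eqP/esym/H1 -> _; apply: Axx ax.
split=> //=.
- exact: Axx ax.
- by move=> v; apply/fr/Hc.
case=> [t' u|t' u c'|t' y|st' y u|st' u] /Hw //=.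
- by case.
- by case.
exact: fr.
Qed.

End Replication.

(** The SLA predicates mention the decided locks of all devices; this carries the safety of a group
    over when those locks advance. *)
Lemma safe_mono H S (Acc Acc' : S -> S -> Prop) (Out Out' : S -> msg H -> Prop)
    (k : kgroup H S) :
  (forall x, Acc (decided k) x -> Acc' (decided k) x) ->
  (forall x m, Out x m -> Out' x m) -> safe Acc Out k -> safe Acc' Out' k.
Proof.
move=> hA hO [ds [Q [Hm Hq HQ Hd Hc Hp Hch Hw]]]; exists ds, Q.
have fr c : copy_ok Acc ds k c -> copy_ok Acc' ds k c.
  by case=> ? h; split=> // /h /hA.
have rp v c : report_ok Acc ds Q k v c -> report_ok Acc' ds Q k v c.
  by case=> ? h; split=> // /h /hA.
split=> //.
- exact: hA.
- by move=> v; apply/fr/Hc.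
- move: Hp; rewrite /pending_ok; case: (pending k) => // -[x out A] [? ? h ?].
  by split=> //; [apply: hA | move=> m /h; apply: hO].
- move: Hch; rewrite /changing_ok.
  case: (changing k) => // -[l G [rs|x A]] [? h].
    by split=> // v c /h; apply: rp.
  by case: h => h ?; split=> //; split=> //; apply: hA.
case=> [t u|t u c|t y|st y u|st u] /Hw //=.
- by move=> [? h]; split=> // E /(h E); apply: rp.
- by move=> [? h]; split=> // E /(h E); apply: hA.
exact: fr.
Qed.

(** * OLA: requests are refused instead of queued *)

Lemma ola_queue_empty (H : home) (s : state H) : reachable OLA s ->
  forall d, safe (fun _ L : lock H => queue L = [::]) (fun _ _ => True)
    (locks s d).
Proof.
elim=> {s} [s [_ hl _ _] d|s s' _ IH st d].
  by have [G [l [kG _ ->]]] := hl d; apply: safe_init.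
have empty e : queue (decided (locks s e)) = [::].
  exact: safe_acc_decided (IH e).
case: st => //= [v _ _|e out k gs|e n1 m n2 L out _ sv].
- exact: safe_crash.
- case: eqP => // _.
  by have [] := safe_group_step _ _ (IH e) gs => // D x /= ->.
case: eqP => // _ rcv; apply: safe_propose => //.
move: rcv; case: m => //= r n e'; case: ifP => // _ [] /(congr1 fst) /= <-.
  rewrite /on_request; case: ifP => /= [_|_]; first exact: empty.
  case: ifP => /= [_|_]; first exact: empty.
  case: ifP => /= [_|_]; first exact: empty.
  by case: (holder _) => [?|] /=; apply: empty.
by rewrite /on_release empty; case: ifP => //= _; apply: empty.
Qed.

(** * SLA: the locking invariant and its preservation *)

Section SequentialLocking.
Context {H : home}.
Implicit Types (L : lock H) (Ls : device H -> lock H) (r : routine H).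
Implicit Types (d : device H).

(* Under SLA an attempt is closed only after it has held the lock, so this    *)
(* never becomes false again.                                                 *)
Definition granted L r n : Prop := holder L = Some (r, n) \/ n < closed L r.

Definition lock_le L L' : Prop :=
  (forall r, closed L r <= closed L' r) /\
  (forall r n, granted L r n -> granted L' r n).

(* Attempts are numbered from 1, hence the [maxn 1]. *)
Definition past_closed Ls r n : Prop :=
  forall e, e \in touched r -> n <= maxn 1 (closed (Ls e) r).

Definition asked Ls r n d : Prop :=
  [/\ 0 < n, d \in touched r, past_closed Ls r n
    & forall e, e \in touched r -> (e < d)%O -> granted (Ls e) r n].

Definition locks_le Ls Ls' : Prop := forall d, lock_le (Ls d) (Ls' d).

(** [L] is separate from [Ls d] because it may be a proposal or a copy not in force. Sortedness
    makes the [by_seq] of a rebuilding leader the identity. *)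
Record lock_ok Ls d L : Prop := LockOk {
  holder_ok : forall r n, holder L = Some (r, n) ->
    closed L r <= n /\ asked Ls r n d;
  queue_ok : forall q, q \in queue L ->
    [/\ closed L q.2.1 <= q.2.2, holder L != Some q.2, q.1 < next_seq L
      & asked Ls q.2.1 q.2.2 d];
  queue_uniq : uniq [seq q.2 | q <- queue L];
  queue_sorted : sorted (fun a b => a.1 <= b.1) (queue L)
}.

Definition msg_ok Ls (m : msg H) : Prop :=
  match m with
  | LockReq r n d => asked Ls r n d
  | Grant r n d => granted (Ls d) r n
  | Refuse _ _ _ => False
  | Release r n d => granted (Ls d) r n
  | Released r n d => n < closed (Ls d) r
  end.

Record run_ok Ls r (p : run H) : Prop := RunOk {
  refused_ok : refused p = set0;
  attempt_ok : past_closed Ls r (attempt p);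
  acquired_ok : forall e, e \in acquired p -> granted (Ls e) r (attempt p);
  phase_ok :
    match phase_of p with
    | Idle => past_closed Ls r (attempt p).+1
    | Acquiring => 0 < attempt p
    | Executing _ => touched r \subset acquired p
    | Releasing => forall e, e \in touched r -> e \notin acquired p ->
                     attempt p < closed (Ls e) r
    | Backoff => False
    end
}.

Lemma past_closed_le Ls Ls' r n :
  locks_le Ls Ls' -> past_closed Ls r n -> past_closed Ls' r n.
Proof.
move=> le h e /h /leq_trans; apply; have [c _] := le e.
by rewrite geq_max leq_maxl (leq_trans (c r) (leq_maxr _ _)).
Qed.

Lemma asked_le Ls Ls' r n d :
  locks_le Ls Ls' -> asked Ls r n d -> asked Ls' r n d.
Proof.
move=> le [n0 dr pc h]; split=> //; first exact: past_closed_le pc.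
by move=> e er /(h e er); have [_ g] := le e; apply: g.
Qed.

Lemma lock_ok_le Ls Ls' d L :
  locks_le Ls Ls' -> lock_ok Ls d L -> lock_ok Ls' d L.
Proof.
move=> le [hh hq hu hs]; split=> // [r n /hh[? a]|q /hq[? ? ? a]].
  by split=> //; apply: asked_le a.
by split=> //; apply: asked_le a.
Qed.

Lemma msg_ok_le Ls Ls' m : locks_le Ls Ls' -> msg_ok Ls m -> msg_ok Ls' m.
Proof.
move=> le; case: m => //= r n d; try by have [_ g] := le d; apply: g.
  exact: asked_le.
by move/leq_trans; apply; have [c _] := le d; apply: c.
Qed.

Lemma run_ok_le Ls Ls' r p : locks_le Ls Ls' -> run_ok Ls r p -> run_ok Ls' r p.
Proof.
move=> le [hr ha hg hp]; split=> //.
- exact: past_closed_le ha.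
- by move=> e /hg; have [_ g] := le e; apply: g.
move: hp; case: (phase_of p) => //; first exact: past_closed_le.
move=> h e et en; apply: leq_trans (h e et en) _.
by have [c _] := le e; apply: c.
Qed.

Lemma by_seq_id Ls d L : lock_ok Ls d L -> by_seq L = L.
Proof.
case=> _ _ _; case: L => h q ns c /= srt; rewrite /by_seq /=.
by rewrite sorted_sort // => x y z; apply: leq_trans.
Qed.

Definition upd Ls d L : device H -> lock H := [eta Ls with d |-> L].

Lemma upd_le Ls d L L' : lock_le L L' -> locks_le (upd Ls d L) (upd Ls d L').
Proof. by move=> le e; rewrite /upd /=; case: eqP. Qed.

Lemma upd_mono Ls Ls' d L :
  locks_le Ls Ls' -> locks_le (upd Ls d L) (upd Ls' d L).
Proof. by move=> le e; rewrite /upd /=; case: eqP. Qed.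

Lemma upd_same Ls d : locks_le Ls (upd Ls d (Ls d)).
Proof. by move=> e; rewrite /upd /=; case: eqP => [->|]. Qed.

(* The [d] component of [Ls] is overwritten so that the relation stays        *)
(* meaningful when [D] is no longer the decided value of [d].                 *)
Definition lock_acc Ls d (D L : lock H) : Prop :=
  lock_ok (upd Ls d D) d L /\ lock_le D L.

Definition lock_out Ls d (L : lock H) (m : msg H) : Prop :=
  msg_ok (upd Ls d L) m.

Record protocol_ok (s : state H) (Ls := fun d => decided (locks s d)) : Prop :=
  ProtocolOk {
    locks_ok : forall d, safe (lock_acc Ls d) (lock_out Ls d) (locks s d);
    runs_ok : forall r,
      safe (fun _ => run_ok Ls r) (fun _ => msg_ok Ls) (runs s r);
    net_ok : forall m, List.In m (net s) -> msg_ok Ls m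
  }.

Lemma decided_lock_ok s d : protocol_ok s ->
  lock_ok (fun e => decided (locks s e)) d (decided (locks s d)).
Proof.
move=> ps; have [ok _] := safe_acc_decided (locks_ok ps d).
by apply: lock_ok_le ok => e; rewrite /upd /=; case: eqP => [->|].
Qed.

Lemma on_request_ok Ls d r n L out : lock_ok Ls d (Ls d) -> asked Ls r n d ->
  on_request SLA d (Ls d) r n = (L, out) ->
  [/\ lock_ok Ls d L, lock_le (Ls d) L
    & forall m, List.In m out -> msg_ok (upd Ls d L) m].
Proof.
move=> ok ask; have [hh hq hu hs] := ok; rewrite /on_request.
case: ltnP => [_ [<- <-]|cl]; first by split.
case: eqP => [hrn [<- <-]|/eqP hrn].
  by split=> // m [<-|[]] /=; rewrite /upd /= eqxx; left.
case: ifP => [_ [<- <-]|nq]; first by split.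
case hE: (holder (Ls d)) => [[r' n']|] [<- <-]; split=> //.
- split=> //=.
  + by move=> r0 n0 [<- <-]; apply: hh.
  + move=> q; rewrite mem_rcons inE => /orP[/eqP->|/hq[? ? lt ?]] /=.
      by rewrite -hE; split.
    by rewrite -hE; split=> //; apply: leqW.
  + by rewrite map_rcons rcons_uniq nq hu.
  have := hs; case qE: (queue (Ls d)) hq => [|q0 q] //= hq.
  rewrite rcons_path => -> /=.
  have /hq[_ _ /ltnW] // : last q0 q \in q0 :: q by apply: mem_last.
- by split=> //= r0 n0; rewrite /granted /= hE.
- split=> //=.
  + by move=> r0 n0 [<- <-].
  move=> q qq; have [? ? ? ?] := hq q qq; split=> //.
  apply/eqP=> -[E]; move/negP: nq; apply; rewrite E; exact: map_f.
- by split=> //= r0 n0; rewrite /granted /= hE => -[//|]; right.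
by move=> m [<-|[]] /=; rewrite /upd /= eqxx; left.
Qed.

Lemma on_release_ok Ls d r n L out :
  lock_ok Ls d (Ls d) -> granted (Ls d) r n ->
  on_release d (Ls d) r n = (L, out) ->
  [/\ lock_ok Ls d L, lock_le (Ls d) L
    & forall m, List.In m out -> msg_ok (upd Ls d L) m].
Proof.
move=> ok gr; have [hh hq hu hs] := ok; rewrite /on_release.
case: eqP => [hrn|/eqP hrn]; last first.
  (* A granted attempt that is not the holder is already closed, so [Released] is a truthful
     answer. *)
  case=> <- <-; split=> // m [<-|[]] /=; rewrite /upd /= eqxx.
  by case: gr => // E; rewrite E eqxx in hrn.
have [cln ask] := hh _ _ hrn.
set cl := close (Ls d) r n.
have clE r0 : cl r0 = if r0 == r then n.+1 else closed (Ls d) r0.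
  rewrite /cl /close /=; case: eqP => // _; apply/maxn_idPr; exact: leqW.
have le_cl h q0 ns : lock_le (Ls d) (Lock h q0 ns cl).
  have c0 r0 : closed (Ls d) r0 <= cl r0.
    by rewrite clE; case: eqP => [->|//]; apply: leqW.
  split=> //= r0 n0 [|lt]; last by right; apply: leq_trans lt (c0 r0).
  by rewrite hrn => -[<- <-]; right; rewrite /= clE eqxx.
(* A queued attempt of [r] other than [n] is later than [n]: had it been      *)
(* earlier, it would be closed, as [r] has moved on to attempt [n].           *)
have okq q : q \in queue (Ls d) -> cl q.2.1 <= q.2.2.
  move=> qq; have [c1 hn _ [n0 _ _ _]] := hq q qq.
  rewrite clE; case: eqP => // E.
  rewrite ltn_neqAle; apply/andP; split.
    by apply: contra hn => /eqP nE; rewrite hrn -E nE; case: (q.2).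
  rewrite leqNgt; apply/negP=> lt; have [_ dt pc _] := ask.
  have := pc d dt; rewrite leq_max.
  case/orP=> h.
    by have := leq_trans lt h; rewrite ltnS leqn0; case: (q.2.2) n0.
  by have := leq_trans lt h; rewrite -E ltnNge c1.
case qE: (queue (Ls d)) => [|[sq [r' n']] q] [<- <-]; split=> //.
- by move=> m [<-|[]] /=; rewrite /upd /= eqxx /= clE eqxx.
- have in0 : (sq, (r', n')) \in queue (Ls d) by rewrite qE mem_head.
  have inq q1 : q1 \in q -> q1 \in queue (Ls d) by rewrite qE inE orbC => ->.
  move: hu hs; rewrite qE /= => /andP[nin uq] srt.
  split=> //=; last exact: path_sorted srt.
  + move=> r0 n0 [<- <-]; split; first exact: (okq _ in0).
    by have [] := hq _ in0.
  move=> q1 qq; have [_ _ ? ?] := hq _ (inq _ qq); split=> //.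
    exact/okq/inq.
  by apply/eqP=> -[E]; move/negP: nin; apply; rewrite E; apply: map_f.
move=> m [<-|[<-|[]]] /=; rewrite /upd /= eqxx; last by left.
by rewrite /= clE eqxx.
Qed.

Lemma acquire_phase_ok Ls r n (acq : {set device H}) :
  past_closed Ls r n -> 0 < n ->
  (forall e, e \in acq -> granted (Ls e) r n) ->
  run_ok Ls r (Run (acquire_phase r acq set0) n acq set0).
Proof.
move=> pc n0 ga; split=> //=; rewrite /acquire_phase setU0 eqxx.
by case: ifP => // /negbFE.
Qed.

Lemma release_phase_ok Ls r n (acq : {set device H}) : past_closed Ls r n ->
  (forall e, e \in acq -> granted (Ls e) r n) ->
  (forall e, e \in touched r -> e \notin acq -> n < closed (Ls e) r) ->
  run_ok Ls r (Run (release_phase acq set0) n acq set0).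
Proof.
move=> pc ga cl; split=> //=; rewrite /release_phase eqxx.
(* With no lock left, every touched device has closed attempt [n], which is what [Idle] demands for
   attempt [n.+1]. *)
case: eqP => //= a0 e er; apply: leq_trans (leq_maxr _ _).
by apply: cl; rewrite // a0 inE.
Qed.

Lemma routine_receive_ok Ls r p m p' : run_ok Ls r p -> msg_ok Ls m ->
  routine_receive r p m = Some p' -> run_ok Ls r p'.
Proof.
move=> [hr ha hg hp]; rewrite /routine_receive.
case: m => //= r' n d; case pE: (phase_of p) hp => // hp mok;
  case: ifP => // /andP[/eqP Er /eqP En] [<-]; rewrite hr Er En in mok *.
  apply: acquire_phase_ok => //.
  by move=> e; rewrite !inE => /orP[/eqP->|/hg].
apply: release_phase_ok => //.
  by move=> e; rewrite !inE => /andP[_ /hg].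
move=> e er; rewrite !inE negb_and negbK => /orP[/eqP->//|].
exact: hp.
Qed.

Lemma routine_local_ok Ls r p p' : run_ok Ls r p -> routine_local r p p' ->
  run_ok Ls r p'.
Proof.
move=> [hr ha hg hp] [E|E|i E _|E]; rewrite ?E in hp => //.
  by apply: acquire_phase_ok => // e; rewrite inE.
rewrite hr; apply: release_phase_ok => // e er.
by rewrite (subsetP hp).
Qed.

Lemma outstanding_ok Ls r p m : run_ok Ls r p ->
  List.In m (outstanding SLA r p) -> msg_ok Ls m.
Proof.
move=> [hr ha hg hp]; rewrite /outstanding.
case: (phase_of p) hp => // hp h; case: (In_map h) => d; last first.
  by rewrite mem_enum => /hg ? ->.
rewrite hr setU0; set T := touched r :\: _.
case tE: (sort _ _) => [|d0 s] //=; rewrite take0 inE => /eqP-> ->.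
have inT e : (e \in d0 :: s) = (e \in T) by rewrite -tE mem_sort mem_enum.
have /andP[_ d0t] : (d0 \notin acquired p) && (d0 \in touched r).
  by have := inT d0; rewrite mem_head inE => <-.
(* The requested [d0] is the least touched device not yet acquired, so all touched devices below it
   are granted. *)
have minT : all (>= d0)%O s.
  apply: order_path_min; first exact: le_trans.
  by have := sort_sorted (@le_total _ (device H)) (enum T); rewrite tE.
split=> // e et lt; apply: hg; apply: contraLR lt => na.
have : e \in d0 :: s by rewrite inT in_setD na et.
by rewrite inE => /orP[/eqP->|/(allP minT) le]; rewrite -leNgt.
Qed.

Lemma protocol_initial s : initial s -> protocol_ok s.
Proof.
case=> _ hl hr hn.
split; last by rewrite hn.
  by move=> d; have [G [l [kG _ ->]]] := hl d; apply: safe_init.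
move=> r; have [G [l [kG _ ->]]] := hr r; apply: safe_init => //.
by split=> //= e; rewrite ?inE // leq_max.
Qed.

Lemma protocol_step s s' : protocol_ok s -> step SLA s s' -> protocol_ok s'.
Proof.
move=> ps st; have [hl hr hn] := ps.
set Ls := fun d => decided (locks s d) in hl hr hn.
have lok d := decided_lock_ok d ps.
have rok r : run_ok Ls r (decided (runs s r)) := safe_acc_decided (hr r).
(* Since locks only advance, it suffices to show the groups safe relative to the old locks [Ls]. *)
have mono s1 : locks_le Ls (fun d => decided (locks s1 d)) ->
    (forall d, safe (lock_acc Ls d) (lock_out Ls d) (locks s1 d)) ->
    (forall r, safe (fun _ => run_ok Ls r) (fun _ => msg_ok Ls) (runs s1 r)) ->
    (forall m, List.In m (net s1) ->
       msg_ok (fun d => decided (locks s1 d)) m) ->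
    protocol_ok s1.
  move=> le hl1 hr1 hn1; split=> //.
    move=> d; apply: safe_mono (hl1 d) => [L [ok le']|L m].
      by split=> //; apply: lock_ok_le ok; apply: upd_mono.
    by apply: msg_ok_le; apply: upd_mono.
  move=> r; apply: safe_mono (hr1 r) => [p|_ m]; first exact: run_ok_le.
  exact: msg_ok_le.
case: st => [v _ _|v _|n1 m n2 E|d out k gs|r out k gs
  |d n1 m n2 L out E sv rcv|r n1 m n2 p E sv rcv|r p sv loc|r sv].
- by apply: mono => //= d; apply: safe_crash.
- exact: mono.
- apply: mono => //= m' m'in; apply: hn; rewrite E; exact: In_mid.
- have [sk [_ le] outok] : [/\ safe (lock_acc Ls d) (lock_out Ls d) k,
      lock_acc Ls d (Ls d) (decided k)
      & forall m, List.In m out -> lock_out Ls d (decided k) m].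
    apply: safe_group_step (hl d) gs => [D L [ok le]|D L [ok le]].
      by split=> //; apply: lock_ok_le ok; apply: upd_le.
    by rewrite (by_seq_id ok); split.
  have leLs : locks_le Ls
      (fun e => decided (locks (State (failed s) [eta locks s with d |-> k]
         (runs s) (net s ++ out)) e)).
    by move=> e /=; case: eqP => [->|].
  apply: mono => //= [e|m mo]; first by case: eqP => [->|].
  case: (In_cat mo) => [/hn|/outok]; apply: msg_ok_le => //.
  by move=> e; rewrite /upd /=; case: eqP.
- have [sk _ outok] : [/\ safe (fun _ => run_ok Ls r) (fun _ => msg_ok Ls) k,
      run_ok Ls r (decided k) & forall m, List.In m out -> msg_ok Ls m].
    by apply: safe_group_step (hr r) gs.
  apply: mono => //= [r'|m mo]; first by case: eqP => [->|].
  by case: (In_cat mo) => [/hn|/outok].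
- have mok : msg_ok Ls m by apply: hn; rewrite E; apply: List.in_elt.
  have [okL leL outL] : [/\ lock_ok Ls d L, lock_le (Ls d) L
      & forall m, List.In m out -> msg_ok (upd Ls d L) m].
    move: rcv mok; case: m {E} => //= r n d'; case: eqP => // -> [E'] mok.
      exact: on_request_ok E'.
    exact: on_release_ok E'.
  apply: mono => /=.
  + by move=> e /=; case: eqP => [->|].
  + move=> e; case: eqP => [->|//]; apply: safe_propose => //.
    by split=> //; apply: lock_ok_le okL; apply: upd_same.
  + exact: hr.
  move=> m' m'in; apply: (@msg_ok_le Ls).
    by move=> e /=; case: eqP => [->|].
  apply: hn; rewrite E; exact: In_mid.
- have mok : msg_ok Ls m by apply: hn; rewrite E; apply: List.in_elt.
  have okp := routine_receive_ok (rok r) mok rcv.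
  apply: mono => //= [r'|m' m'in]; last by apply: hn; rewrite E; apply: In_mid.
  case: eqP => [->|//]; apply: safe_propose => // m'.
  exact: outstanding_ok okp.
- have okp := routine_local_ok (rok r) loc.
  apply: mono => //= r'; case: eqP => [->|//]; apply: safe_propose => // m'.
  exact: outstanding_ok okp.
apply: mono => //= m mo; case: (In_cat mo) => [/hn//|].
exact: outstanding_ok (rok r).
Qed.

(** * Device order along the wait-for relation *)

(** If the holding and queued attempts differ, the later one certifies that the earlier is closed
    everywhere, yet neither is closed where it stands. If they agree, [d' < d] would mean that [d']
    was granted before [d] was requested, and [d' = d] that the holder is also queued. *)
Lemma holds_lt_requests s r d d' : protocol_ok s ->
  holds s r d -> requests s r d' -> (d < d')%O.
Proof.
move=> ps hd /mapP[[sq [r0 n]] qin /= r0E]; rewrite -{}r0E in qin.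
have [hh _ _ _] := decided_lock_ok d ps.
have [_ hq _ _] := decided_lock_ok d' ps.
move: hd; rewrite /holds; case hE: (holder _) => [[r1 m]|] //= /eqP[E].
rewrite {}E in hE; have [cm [m0 dt pm am]] := hh _ _ hE.
have [/= cn hn _ [n0 d't pn an]] := hq _ qin.
have [mn|nm|E] := ltngtP m n.
- have := pn d dt; rewrite leq_max leqNgt (leq_ltn_trans m0 mn) /=.
  by move/(leq_trans mn); rewrite ltnNge cm.
- have := pm d' d't; rewrite leq_max leqNgt (leq_ltn_trans n0 nm) /=.
  by move/(leq_trans nm); rewrite ltnNge cn.
rewrite {}E in hE am; have [//|d'd|dd] := ltgtP d d'.
  case: (am d' d't d'd) => [E|]; last by rewrite ltnNge cn.
  by rewrite E eqxx in hn.
by rewrite -dd hE eqxx in hn.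
Qed.

Lemma holds_path_lt_requests s (c : seq (routine H)) r d d' : protocol_ok s ->
  holds s r d -> path (waits_for s) r c -> requests s (last r c) d' ->
  (d < d')%O.
Proof.
move=> ps; elim: c r d => [|r1 c IH] r d hd /=.
  by move=> _; apply: holds_lt_requests.
case/andP=> /existsP[e /andP[re he]] pc lq.
exact: lt_trans (holds_lt_requests ps hd re) (IH _ _ he pc lq).
Qed.

End SequentialLocking.

Theorem theorem2 (H : home) (str : strategy) (s : state H) :
  reachable str s -> forall r r' : routine H, ~ deadlocked s r r'.
Proof.
move=> rs r r' [[|x c] [cyc //_ _]]; move: cyc; rewrite /= rcons_path.
(* The closing edge gives one device [d] held by [x] and awaited at the end of the path. *)
case/andP=> pc /existsP[d /andP[rq hd]].
case: str rs => rs; last first.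
  have /safe_acc_decided e := ola_queue_empty rs d.
  by move: rq; rewrite /requests e.
have ps : protocol_ok s.
  elim: rs => [s1|s1 s2 _ ps]; first exact: protocol_initial.
  exact: protocol_step.
by have := holds_path_lt_requests ps hd pc rq; rewrite ltxx.
Qed.
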